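(* Let $g(x_1,\ldots,x_n)$ be a term in which no variable occurs more than once, and consider the interval constraint satisfaction problem (ICSP) $\mathcal{S}$ obtained from the tree $T$ of the atomic formula $g(x_1,\ldots,x_n)\leq 0$. Suppose the generic propagation algorithm GPA is modified so that the active set is initialized to contain only the seed constraints of $\mathcal{S}$ instead of all constraints. Suppose also that the active set is a priority queue in which the constraints are ordered according to the level they occupy in the tree $T$, with those that are further away from the root placed nearer to the front of the queue. Then GPA so modified, applied to $\mathcal{S}$, terminates with the same result as when the active set would have been initialized to contain all constraints of $\mathcal{S}$.
   Context: **Intervals.** Let $F$ be a fixed finite set of reals. A floating-point number is an element of $F\cup\{-\infty,+\infty\}$. An interval is a closed connected set of reals whose bounds, in so far as they exist, are floating-point numbers; $[-\infty,+\infty]$ denotes the whole real line. **Constraints, DROs, ICSPs.** A constraint is an atomic formula $c(x_1,\ldots,x_n)$ without function symbols; its predicate symbol denotes a relation $r$ on the reals. Each variable $x_i$ has a domain $X_i$. A value $a_i$ for $x_i$ is inconsistent with respect to $r$ and the domains $X_j$ ($j\neq i$) iff there are no $a_j\in X_j$ ($j\ne i$) with $\langle a_1,\ldots,a_n\rangle\in r$. A domain reduction operator (DRO) for $c$ may replace domains of the variables of $c$ by subsets, removing only inconsistent values; every DRO is contracting, monotonic and idempotent. It is optimal if every domain is replaced by the smallest domain containing all its consistent values. A constraint is primitive if an (efficiently computable) optimal DRO is available for it; this is the DRO associated with the constraint. An ICSP is a finite set of primitive constraints together with an interval as domain for each variable. **Default domains and seed constraints.** The default domain of an argument of a constraint is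 the domain of that argument after applying the DRO of the constraint when all its variables have domain $[-\infty,+\infty]$ (e.g. for $sin(x,y)$, meaning $y=\sin x$, the default domain of $y$ is $[-1,1]$). A constraint of an ICSP is a seed constraint iff at least one of its variables has a domain that differs from the default domain of that variable as an argument of that constraint. **Tree form and translation.** An atomic formula is viewed as a tree: the predicate symbol is the root, and its argument terms are the subtrees; a term is a variable (a leaf) or a function symbol with its argument terms as subtrees. Every node that is a function symbol is labeled with a unique new variable. Constants are replaced by unique variables whose domains contain the constants and are as small as possible. The ICSP obtained from the tree has exactly one constraint for each internal node. The root, with predicate symbol $p$ and children labeled by (or being) variables $x_0,\ldots,x_{n-1}$, yields $p(x_0,\ldots,x_{n-1})$. A non-root internal node $f(t_0,\ldots,t_{n-1})$ labeled by $y$, with children labeled by (or being) $x_0,\ldots,x_{n-1}$, yields $F(x_0,\ldots,x_{n-1},y)$, where $F(a_0,\ldots,a_{n-1},v)$ holds iff $v=f(a_0,\ldots,a_{n-1})$. The level of a constraint is that of the node that generated it. **GPA.** The generic propagation algorithm maintains a set $A$ of constraints, the active set, initialized to contain all constraints. While $A\neq\emptyset$: choose a constraint $C$ from $A$ (in unspecified order); apply the DRO associated with $C$; if one of the domains has become empty, stop; add to $A$ all constraints involving variables whose domains have changed, if any; remove $C$ from $A$. The result is failure if the algorithm stops because a domain has become empty; otherwise it is the collection of domains of the variables when $A=\emptyset$. *)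

(* Defs.v *)
From HB Require Import structures.
From mathcomp Require Import all_boot all_order all_algebra.
From mathcomp Require Import all_classical all_reals all_analysis.
Set Implicit Arguments.
Unset Strict Implicit.
Unset Printing Implicit Defensive.
Import Order.TTheory GRing.Theory Num.Theory.
Import numFieldNormedType.Exports.
Local Open Scope classical_set_scope.
Local Open Scope ring_scope.

Section Intervals.
Context {R : realType} (F : set R).

(* The empty set and the whole line satisfy this vacuously on the side of the
   bounds; the empty set must be an admissible domain for failure to arise. *)
Definition fp_interval (D : set R) : Prop :=
  [/\ closed D, connected D, has_sup D -> F (sup D) & has_inf D -> F (inf D)].

Definition smallest_interval (S D : set R) : Prop :=
  [/\ fp_interval D, S `<=` D &
      forall D', fp_interval D' -> S `<=` D' -> D `<=` D'].

Definition box (n : nat) := 'I_n -> set R.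

Definition fp_box n (X : box n) : Prop := forall i, fp_interval (X i).

Definition inconsistent n (r : set ('I_n -> R)) (X : box n) (i : 'I_n)
    (a : R) : Prop :=
  ~ exists b : 'I_n -> R,
      [/\ b i = a, (forall j, j != i -> X j (b j)) & r b].

Definition is_dro n (r : set ('I_n -> R)) (d : box n -> box n) : Prop :=
  [/\ (forall X, fp_box X -> fp_box (d X)),
      (forall X, fp_box X -> forall i, d X i `<=` X i),
      (forall X, fp_box X -> forall i a,
         X i a -> ~ d X i a -> inconsistent r X i a),
      (forall X Y, fp_box X -> fp_box Y -> (forall i, X i `<=` Y i) ->
         forall i, d X i `<=` d Y i) &
      (forall X, fp_box X -> d (d X) = d X)].

Definition optimal n (r : set ('I_n -> R)) (d : box n -> box n) : Prop :=
  forall X, fp_box X -> forall i,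
    smallest_interval [set a | X i a /\ ~ inconsistent r X i a] (d X i).

(* A predicate symbol comes with the relation it denotes and with the operator
   associated with its constraints. *)
Record pred_symbol := PredSymbol {
  parity : nat;
  prel : set ('I_parity -> R);
  pdro : box parity -> box parity }.

Definition primitive (p : pred_symbol) : Prop :=
  is_dro (@prel p) (@pdro p) /\ optimal (@prel p) (@pdro p).

Definition default_domain (p : pred_symbol) (i : 'I_(parity p)) : set R :=
  pdro (fun=> setT) i.

End Intervals.

Arguments box : clear implicits.
Arguments pred_symbol : clear implicits.

Section ICSP.
Context {R : realType} {V : Type}.

Record constraint := Constraint {
  csym : pred_symbol R;
  cargs : 'I_(parity csym) -> V }.

Record icsp := Icsp {
  con : finType;
  cstr : con -> constraint;
  dom : V -> set R }.

(* The variables of an ICSP are those that are arguments of its constraints;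
   propagation leaves a domain assignment unchanged elsewhere. *)
Definition well_formed (F : set R) (S : icsp) : Prop :=
  forall c : con S, primitive F (csym (cstr c)) /\
    forall i, fp_interval F (dom S (cargs (c := cstr c) i)).

Definition seed (S : icsp) (c : con S) : Prop :=
  exists i : 'I_(parity (csym (cstr c))),
    dom S (cargs i) <> default_domain i.

Definition seeds (S : icsp) : {set con S} := finset (fun c => `[< seed c >]).

(* The operator acts on argument positions; a variable keeps the values that
   are kept at every position at which it occurs. *)
Definition apply_dro (c : constraint) (D : V -> set R) : V -> set R :=
  fun x => [set a | D x a /\ forall i : 'I_(parity (csym c)),
                      cargs i = x -> pdro (fun j => D (cargs (c := c) j)) i a].

Definition has_empty (S : icsp) (D : V -> set R) : Prop :=
  exists (c : con S) (i : 'I_(parity (csym (cstr c)))), D (cargs i) = set0.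

Definition affected (S : icsp) (D D' : V -> set R) : {set con S} :=
  finset (fun c => `[< exists i : 'I_(parity (csym (cstr c))),
                         D' (cargs i) <> D (cargs i) >]).

Inductive outcome := Failure | Domains of (V -> set R).

Inductive config (S : icsp) :=
  | Run of {set con S} & (V -> set R)
  | Stop of outcome.

Arguments Stop {S}.

(* [sel A c] says that c may be chosen when the active set is A. *)
Definition selection (S : icsp) := {set con S} -> con S -> Prop.

Inductive gpa_step (S : icsp) (sel : selection S) :
    config S -> config S -> Prop :=
  | gpa_end D :
      gpa_step sel (Run finset.set0 D) (Stop (Domains D))
  | gpa_fail (A : {set con S}) D c :
      c \in A -> sel A c -> has_empty S (apply_dro (cstr c) D) ->
      gpa_step sel (Run A D) (Stop Failure)
  | gpa_next (A : {set con S}) D c :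
      c \in A -> sel A c -> ~ has_empty S (apply_dro (cstr c) D) ->
      gpa_step sel (Run A D)
        (Run ((A :|: affected S D (apply_dro (cstr c) D)) :\ c)
             (apply_dro (cstr c) D)).

(* Every maximal execution from the configuration is finite and stops with
   outcome o. *)
Inductive always_ends (S : icsp) (sel : selection S) (o : outcome) :
    config S -> Prop :=
  | ends_now : always_ends sel o (Stop o)
  | ends_later k :
      (exists k', gpa_step sel k k') ->
      (forall k', gpa_step sel k k' -> always_ends sel o k') ->
      always_ends sel o k.

Definition gpa_result (S : icsp) (sel : selection S) (A0 : {set con S})
    (o : outcome) : Prop :=
  always_ends sel o (Run A0 (dom S)).

Definition all_constraints (S : icsp) : {set con S} := finset predT.

Definition any_order (S : icsp) : selection S := fun _ _ => True.

Definition deepest_first (S : icsp) (level : con S -> nat) : selection S :=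
  fun A c => forall c', c' \in A -> (level c' <= level c)%N.

End ICSP.

Arguments constraint : clear implicits.
Arguments icsp : clear implicits.
Arguments outcome : clear implicits.
Arguments any_order {R V} S.
Arguments all_constraints {R V} S.

Section Trees.
Context {R : realType}.

(* Functions may be partial; [None] means undefined. Constants are not nullary
   function symbols but a separate kind of leaf. *)
Record fun_symbol := FunSymbol {
  farity : nat;
  farity_gt0 : (0 < farity)%N;
  fval : ('I_farity -> R) -> option R;
  fdro : box R farity.+1 -> box R farity.+1 }.

Definition graph_symbol (f : fun_symbol) : pred_symbol R :=
  PredSymbol (parity := (farity f).+1)
    [set b | fval (fun i : 'I_(farity f) => b (lift ord_max i))
             = Some (b ord_max)]
    (@fdro f).

Inductive term (n : nat) :=
  | Var of 'I_n
  | Const of R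
  | App (f : fun_symbol) of ('I_(farity f) -> term n).

Fixpoint occurrences n (t : term n) : seq 'I_n :=
  match t with
  | Var x => [:: x]
  | Const _ => [::]
  | App f ts => flatten [seq occurrences (ts i) | i <- enum 'I_(farity f)]
  end.

Record atom (n : nat) := Atom {
  apred : pred_symbol R;
  aargs : 'I_(parity apred) -> term n }.

(* A node is identified by the list of child indices leading to it from the
   root; its level is the length of that list. The new variables that label
   function nodes and replace constants are named after their nodes. *)
Definition address := seq nat.

Inductive tvar (n : nat) := User of 'I_n | New of address.

Definition label n (p : address) (t : term n) : tvar n :=
  if t is Var x then User x else New n p.

Fixpoint constants n (p : address) (t : term n) : seq (address * R) :=
  match t with
  | Var _ => [::]
  | Const c => [:: (p, c)]
  | App f ts =>
      flatten [seq constants (rcons p (nat_of_ord i)) (ts i)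
              | i <- enum 'I_(farity f)]
  end.

Fixpoint node_constraints n (p : address) (t : term n) :
    seq (address * constraint R (tvar n)) :=
  match t with
  | App f ts =>
      (p, @Constraint R (tvar n) (graph_symbol f)
            (fun i : 'I_(farity f).+1 =>
               if unlift ord_max i is Some j
               then label (rcons p (nat_of_ord j)) (ts j) else New n p))
      :: flatten [seq node_constraints (rcons p (nat_of_ord i)) (ts i)
                 | i <- enum 'I_(farity f)]
  | _ => [::]
  end.

Definition atom_constants n (a : atom n) : seq (address * R) :=
  flatten [seq constants [:: nat_of_ord i] (aargs (a := a) i)
          | i <- enum 'I_(parity (apred a))].

Definition atom_constraints n (a : atom n) :
    seq (address * constraint R (tvar n)) :=
  ([::], @Constraint R (tvar n) (apred a)
           (fun i => label [:: nat_of_ord i] (aargs i)))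
  :: flatten [seq node_constraints [:: nat_of_ord i] (aargs (a := a) i)
             | i <- enum 'I_(parity (apred a))].

Definition tree_icsp n (a : atom n) (D0 : tvar n -> set R) :
    icsp R (tvar n) :=
  @Icsp R (tvar n) 'I_(size (atom_constraints a))
    (fun c => (tnth (in_tuple (atom_constraints a)) c).2) D0.

Definition tree_level n (a : atom n) (D0 : tvar n -> set R)
    (c : con (tree_icsp a D0)) : nat :=
  size (tnth (in_tuple (atom_constraints a)) c).1.

Definition constant_domains (F : set R) n (a : atom n)
    (D0 : tvar n -> set R) : Prop :=
  forall p c, (p, c) \in atom_constants a ->
    smallest_interval F [set c] (D0 (New n p)).

Definition le_symbol (d : box R 2 -> box R 2) : pred_symbol R :=
  PredSymbol [set b : 'I_2 -> R | b ord0 <= b ord_max] d.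

Definition le_zero n (d : box R 2 -> box R 2) (g : term n) : atom n :=
  @Atom n (le_symbol d) (fun i : 'I_2 => if i == ord0 then g else Const n 0).

End Trees.

Arguments fun_symbol : clear implicits.
Arguments term : clear implicits.
Arguments atom : clear implicits.

(* Main.v *)
Require Import Defs.
From mathcomp Require Import all_boot all_order all_algebra.
From mathcomp Require Import finmap all_classical all_reals all_analysis.

Set Implicit Arguments.
Unset Strict Implicit.
Unset Printing Implicit Defensive.
Import Order.TTheory GRing.Theory Num.Theory.

(** Neither the initial active set nor the order of selection influences the
    result, as long as every constraint left out of the initial active set is
    already stable, that is, its DRO changes nothing.

    Monotonicity gives the domains of an ICSP a greatest collection [G] of
    subdomains that all DROs leave unchanged ([greatest_stable_exists]). Every
    run keeps two properties: its domains contain [G], and the inactive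
    constraints are stable. The second one needs the constraint that has just
    been applied to be stable afterwards; this follows from idempotence of its
    DRO when its argument variables are distinct, for then the DRO acts on each
    variable through a single position. A run that ends with an empty active
    set has therefore reached [G], and a run that meets an empty domain shows
    that [G] has one. Runs are finite because a finite set of floating-point
    numbers bounds only finitely many intervals ([finite_fp_interval]). So the
    result is failure if [G] has an empty domain, and [G] otherwise
    ([gpa_always_ends], [gpa_result_eq]).

    It remains to see that starting with the seeds is admissible for the tree
    of [g <= 0]. A constraint that is not a seed has its default domains, which
    are the value of an idempotent operator and hence stable. Argument
    variables are distinct since no variable occurs twice in [g]
    ([le_zero_args_inj]). One degenerate case is left: without seeds, the
    modified algorithm ends at once without looking for empty domains, so there
    must be none. Optimality makes a stable constraint with one nonempty domain
    have only nonempty ones; nonemptiness thus descends the tree from the root,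
    where the default domains contain 0 ([no_seed_no_empty]). *)

(** * Floating-point intervals *)

Section FloatingPointIntervals.
Local Open Scope fset_scope.
Local Open Scope classical_set_scope.
Context {R : realType} {F : set R}.

Lemma fp_interval_set0 : fp_interval F set0.
Proof.
split; [exact: closed0 | exact: connected0 | |].
- by case=> [[x []]].
- by case=> [[x []]].
Qed.

Lemma fp_interval_setT : fp_interval F setT.
Proof.
split; [exact: closedT | by apply/connected_intervalP => x y _ _ z _ | |].
- by case=> _ [x] /(_ (x + 1)%R I); rewrite leNgt ltrDl ltr01.
- by case=> _ [x] /(_ (x - 1)%R I); rewrite leNgt ltrBlDr ltrDl ltr01.
Qed.

(** An interval is recovered from its hull, whose finite endpoints are its
    infimum and supremum and so lie in [F]. *)
Lemma finite_fp_interval : finite_set F -> finite_set (fp_interval F).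
Proof.
move=> finF.
pose ends : set (itv_bound R) :=
  [set BInfty R true; BInfty R false] `|` [set BSide b x | b in setT & x in F].
have fin_ends : finite_set ends.
  rewrite finite_setU; split; first exact: finite_set2.
  by apply: finite_image2 => //; exact: finite_finset.
pose fp_itvs : set (set R) :=
  set0 |` [set [set` Interval lo hi] | lo in ends & hi in ends].
apply: (@sub_finite_set _ _ fp_itvs); last first.
  by rewrite finite_setU; split; [exact: finite_set1 | exact: finite_image2].
move=> I [_ /connected_intervalP /is_intervalP eqI supF infF].
have [->|/set0P I0] := eqVneq I set0; first by left.
right; rewrite eqI /Rhull.
exists (if `[< has_lbound I >] then BSide `[< I (inf I) >] (inf I)
        else BInfty R true).
  case: asboolP => [lbI|_]; last by left; left.
  by right; exists `[< I (inf I) >] => //; exists (inf I) => //; exact: infF.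
exists (if `[< has_ubound I >] then BSide (~~ `[< I (sup I) >]) (sup I)
        else BInfty R false).
  case: asboolP => [ubI|_]; last by left; right.
  by right; exists (~~ `[< I (sup I) >]) => //; exists (sup I) => //; exact: supF.
done.
Qed.

Definition fp_below (D : set R) : set (set R) :=
  [set I | fp_interval F I /\ I `<=` D].

(** A floating-point interval is counted in its own height, so the height drops
    when a proper subset replaces it. *)
Definition fp_height (D : set R) : nat :=
  #|` fset_set (fp_below D)|.

Context (finF : finite_set F).

Lemma finite_fp_below D : finite_set (fp_below D).
Proof.
by apply: sub_finite_set (finite_fp_interval finF) => I [].
Qed.

Lemma fp_height_sub D E : D `<=` E -> fp_height D <= fp_height E.
Proof.
move=> DE; apply: fsubset_leq_card; rewrite -fset_set_sub;
  try exact: finite_fp_below.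
by move=> I [fpI ID]; split=> //; exact: subset_trans DE.
Qed.

Lemma fp_height_proper D E :
  fp_interval F E -> D `<=` E -> D <> E -> fp_height D < fp_height E.
Proof.
move=> fpE DE neDE; apply: fproper_ltn_card; rewrite fproperE.
apply/andP; split.
  rewrite -fset_set_sub; try exact: finite_fp_below.
  by move=> I [fpI ID]; split=> //; exact: subset_trans DE.
apply/negP; rewrite -fset_set_sub; try exact: finite_fp_below.
by move=> /(_ E (conj fpE (@subset_refl _ E)))[_ ED]; apply: neDE; apply/seteqP.
Qed.

End FloatingPointIntervals.

Arguments fp_height {R} F D.

(** * Propagation *)

Section Propagation.
Local Open Scope classical_set_scope.
Context {R : realType} {V : Type} {F : set R} (finF : finite_set F).
Context (S : icsp R V).
Context (primS : forall c : con S, primitive F (csym (cstr c))).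
Context (injS : forall c : con S, injective (cargs (c := cstr c))).

Implicit Types (c : con S) (D E : V -> set R) (A : {set con S}).

Definition fp_doms D := forall c i, fp_interval F (D (cargs (c := cstr c) i)).

Definition subdoms D E := forall x, D x `<=` E x.

Definition stable c D := apply_dro (cstr c) D = D.

Lemma apply_dro_sub c D : subdoms (apply_dro (cstr c) D) D.
Proof. by move=> x a []. Qed.

(** With distinct arguments, the conditions that [apply_dro] imposes on a
    variable come from one position only. *)
Lemma apply_dro_arg c D i : fp_doms D ->
  apply_dro (cstr c) D (cargs (c := cstr c) i) =
  pdro (fun j => D (cargs (c := cstr c) j)) i.
Proof.
move=> fpD; have [[_ dsub _ _ _] _] := primS c.
apply/seteqP; split=> a; first by case=> _; apply.
move=> da; split; first by apply: (dsub (fun j => D (cargs j))) => // j.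
by move=> j /injS ->.
Qed.

Lemma apply_dro_agree c D x :
  (forall i, cargs (c := cstr c) i = x -> apply_dro (cstr c) D x = D x) ->
  apply_dro (cstr c) D x = D x.
Proof.
move=> agree; have [[i /agree //]|noarg] :=
  pselect (exists i, cargs (c := cstr c) i = x).
apply/seteqP; split=> a; first by case.
by move=> Da; split=> // i argi; case: noarg; exists i.
Qed.

Lemma apply_dro_fp c D : fp_doms D -> fp_doms (apply_dro (cstr c) D).
Proof.
move=> fpD c' i'; have [[dfp _ _ _ _] _] := primS c.
have [[i <-]|noarg] := pselect (exists i, cargs (c := cstr c) i = cargs i').
  by rewrite apply_dro_arg //; apply: dfp => j.
rewrite apply_dro_agree; first exact: fpD.
by move=> i argi; case: noarg; exists i.
Qed.

Lemma apply_dro_mono c D E : fp_doms D -> fp_doms E -> subdoms D E ->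
  subdoms (apply_dro (cstr c) D) (apply_dro (cstr c) E).
Proof.
move=> fpD fpE DE x a [Da da]; split; first exact: DE.
move=> i /da; have [[_ _ _ dmono _] _] := primS c.
by apply: dmono => // j; exact: DE.
Qed.

Lemma stableP c D : fp_doms D ->
  stable c D <-> pdro (fun j => D (cargs (c := cstr c) j)) =
                 (fun j => D (cargs (c := cstr c) j)).
Proof.
move=> fpD; split=> [stab|fixD].
  by apply/funext => i; rewrite -apply_dro_arg // stab.
apply/funext => x; apply: apply_dro_agree => i <-.
by rewrite apply_dro_arg // fixD.
Qed.

(** This is why the algorithm may deactivate the constraint it has just applied:
    on its arguments the new domains are the value of the DRO, and the DRO is
    idempotent. *)
Lemma apply_dro_stable c D : fp_doms D -> stable c (apply_dro (cstr c) D).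
Proof.
move=> fpD; apply/stableP; first exact: apply_dro_fp.
have [[_ _ _ _ idem] _] := primS c.
rewrite (_ : (fun j => _) = pdro (fun j => D (cargs (c := cstr c) j))).
  by apply: idem => j.
by apply/funext => i; rewrite apply_dro_arg.
Qed.

Lemma stable_agree c D E : fp_doms D -> fp_doms E ->
  (forall i, E (cargs (c := cstr c) i) = D (cargs (c := cstr c) i)) ->
  stable c D -> stable c E.
Proof.
move=> fpD fpE agree /(stableP c fpD) fixD; apply/stableP => //.
by rewrite (_ : (fun j => E _) = (fun j => D (cargs (c := cstr c) j)));
  last exact/funext.
Qed.

(** The default domains are the image of the whole space under the DRO, so
    idempotence fixes them. *)
Lemma nonseed_stable c : fp_doms (dom S) -> ~ seed c -> stable c (dom S).
Proof.
move=> fpD nseed; apply/stableP => //.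
have [[_ _ _ _ idem] _] := primS c.
rewrite (_ : (fun j => _) = pdro (fun=> setT)).
  by apply: idem => i; exact: fp_interval_setT.
apply/funext => i; apply: contrapT => ne; apply: nseed; by exists i.
Qed.

(** If the domain of [j] is empty then every value at [i] is inconsistent, and
    an optimal DRO reduces the domain of [i] to the smallest interval containing
    nothing, the empty one. *)
Lemma stable_inhabited c D i j : fp_doms D -> stable c D ->
  D (cargs (c := cstr c) i) !=set0 -> D (cargs (c := cstr c) j) !=set0.
Proof.
move=> fpD /(stableP c fpD) fixD [a Da]; apply/set0P/eqP => Dj0.
have [_ opt] := primS c.
have fpX : fp_box F (fun k => D (cargs (c := cstr c) k)) by move=> k.
have [_ _ /(_ _ fp_interval_set0)] := opt _ fpX i.
rewrite fixD; apply; last exact: Da.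
move=> b [Db] /contrapT[v [vb vD _]].
have [ij|ij] := eqVneq i j; first by move: Db; rewrite ij Dj0.
by have := vD j; rewrite eq_sym ij Dj0 => /(_ isT).
Qed.

Definition total_height D : nat :=
  \sum_(c : con S) \sum_(i < parity (csym (cstr c)))
    fp_height F (D (cargs (c := cstr c) i)).

Lemma total_height_decr D E c i : fp_doms E -> subdoms D E ->
  D (cargs (c := cstr c) i) <> E (cargs (c := cstr c) i) ->
  total_height D < total_height E.
Proof.
move=> fpE DE ne; rewrite /total_height (bigD1 c) //= [ltnRHS](bigD1 c) //=.
rewrite (bigD1 i) //= [in ltnRHS](bigD1 i) //= -!addnA -addSn.
apply: leq_add; first exact: fp_height_proper.
apply: leq_add; apply: leq_sum => *; first exact: fp_height_sub.
by apply: leq_sum => *; exact: fp_height_sub.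
Qed.

Lemma apply_dro_progress c D : ~ stable c D -> fp_doms D ->
  total_height (apply_dro (cstr c) D) < total_height D.
Proof.
move=> nstab fpD.
have [[i ne]|agree] := pselect (exists i,
    apply_dro (cstr c) D (cargs (c := cstr c) i) <> D (cargs i)).
  exact: (total_height_decr fpD (@apply_dro_sub c D) ne).
case: nstab; apply/funext => x; apply: apply_dro_agree => i <-.
by apply: contrapT => ne; apply: agree; exists i.
Qed.

Definition greatest_stable D G :=
  [/\ fp_doms G, subdoms G D, forall c, stable c G &
      forall E, fp_doms E -> subdoms E D -> (forall c, stable c E) ->
        subdoms E G].

(** Apply DROs that change something until none is left; by monotonicity, no
    step removes anything from a stable collection below. *)
Lemma greatest_stable_exists D : fp_doms D -> exists G, greatest_stable D G.
Proof.
have [n] := ubnP (total_height D); elim: n D => // n IHn D ltn fpD.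
have [stab|/existsNP[c nstab]] := pselect (forall c, stable c D).
  by exists D; split=> // x; exact: subset_refl.
have lt := apply_dro_progress nstab fpD.
have [G [fpG GD stabG maxG]] :=
  IHn _ (leq_trans lt ltn) (apply_dro_fp c fpD).
exists G; split=> // [x|E fpE ED stabE].
  by apply: subset_trans (GD x) _; exact: apply_dro_sub.
apply: maxG => //; rewrite -(stabE c); exact: apply_dro_mono.
Qed.

Definition outcome_of G : outcome R V :=
  if `[< has_empty S G >] then Failure else Domains G.

Lemma has_empty_sub D E : subdoms D E -> has_empty S E -> has_empty S D.
Proof.
move=> DE [c [i Ei0]]; exists c, i.
by apply/seteqP; split=> // a /DE; rewrite Ei0.
Qed.

(** The outcome depends neither on [A] nor on [sel].
    By induction on the total height of the domains, then on the number of
    active constraints: a step that changes no domain only deactivates. The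
    last hypothesis matters for the initial configuration alone, because
    emptiness is tested only after a DRO has been applied. *)
Lemma gpa_always_ends (sel : selection S) G A D :
  (forall A', A' != finset.set0 -> exists2 c, c \in A' & sel A' c) ->
  fp_doms D -> greatest_stable (dom S) G ->
  subdoms D (dom S) -> subdoms G D ->
  (forall c, c \notin A -> stable c D) ->
  (A = finset.set0 -> ~ has_empty S D) ->
  always_ends sel (outcome_of G) (Run A D).
Proof.
move=> selP + gfpG.
have [fpG _ stabG maxG] := gfpG.
have [n] := ubnP (total_height D); elim: n D A => // n IHn D A.
have [m] := ubnP #|A|; elim: m A => // m IHm A ltm ltn fpD DD0 GD stabD noempty.
apply: ends_later.
  have [->|/selP[c Ac selc]] := eqVneq A finset.set0.
    by eexists; exact: gpa_end.
  have [fail|nfail] := pselect (has_empty S (apply_dro (cstr c) D)).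
    by eexists; exact: (gpa_fail Ac selc fail).
  by eexists; exact: (gpa_next Ac selc nfail).
move=> k' step.
inversion step as [D' eqA|A' D' c Ac selc fail|A' D' c Ac selc nfail]; subst.
- have -> : outcome_of G = Domains D; last exact: ends_now.
  have eqGD : G = D.
    apply/funext => x; apply/seteqP; split; first exact: GD.
    by apply: maxG => // c; apply: stabD; rewrite inE.
  by rewrite /outcome_of eqGD; case: asboolP => // /noempty; case.
- have -> : outcome_of G = Failure; last exact: ends_now.
  rewrite /outcome_of asboolT //; apply: has_empty_sub fail.
  by rewrite -(stabG c); exact: apply_dro_mono.
- have fpcD := apply_dro_fp c fpD.
  have cDD0 : subdoms (apply_dro (cstr c) D) (dom S).
    by move=> x; apply: subset_trans (DD0 x); exact: apply_dro_sub.
  have GcD : subdoms G (apply_dro (cstr c) D).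
    by rewrite -(stabG c); exact: apply_dro_mono.
  have stabcD c' : c' \notin (A :|: affected S D (apply_dro (cstr c) D)) :\ c ->
      stable c' (apply_dro (cstr c) D).
    rewrite !inE negb_and negbK => /orP[/eqP->|]; first exact: apply_dro_stable.
    rewrite negb_or => /andP[/stabD stab /asboolPn unaff].
    apply: (stable_agree fpD) stab => // i.
    by apply: contrapT => ne; apply: unaff; exists i.
  have [stab|nstab] := pselect (stable c D); last first.
    by apply: IHn => //; exact: leq_trans (apply_dro_progress nstab fpD) ltn.
  move: stabcD nfail; rewrite stab => stabcD nfail.
  apply: IHm => //.
  have -> : affected S D D = finset.set0.
    by apply/setP => c'; rewrite !inE; apply/asboolPn => -[i []].
  by move: ltm; rewrite finset.setU0 ltnS (cardsD1 c A) Ac.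
Qed.

Lemma gpa_result_eq (sel sel' : selection S) A A' :
  (forall B, B != finset.set0 -> exists2 c, c \in B & sel B c) ->
  (forall B, B != finset.set0 -> exists2 c, c \in B & sel' B c) ->
  fp_doms (dom S) ->
  (forall c, c \notin A -> stable c (dom S)) ->
  (forall c, c \notin A' -> stable c (dom S)) ->
  (A = finset.set0 -> ~ has_empty S (dom S)) ->
  (A' = finset.set0 -> ~ has_empty S (dom S)) ->
  exists o, gpa_result sel A o /\ gpa_result sel' A' o.
Proof.
move=> selP selP' fpD stabA stabA' neA neA'.
have [G gfpG] := greatest_stable_exists fpD.
have [_ GD _ _] := gfpG.
exists (outcome_of G); split; apply: gpa_always_ends => // x;
  exact: subset_refl.
Qed.

End Propagation.

Arguments fp_doms {R V} F S D.

(** * Constraints of a tree *)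

Lemma all_flatten (T : Type) (a : pred T) (ss : seq (seq T)) :
  all a (flatten ss) = all (all a) ss.
Proof. by elim: ss => //= s ss IHss; rewrite all_cat IHss. Qed.

Section TreeConstraints.
Local Open Scope classical_set_scope.
Context {R : realType} {n : nat}.

Definition linear (t : term R n) :=
  forall x : 'I_n, count_mem x (occurrences t) <= 1.

Lemma linear_sub (f : fun_symbol R) (ts : 'I_(farity f) -> term R n) i :
  linear (App ts) -> linear (ts i).
Proof.
move=> lin x; have := lin x.
rewrite /= count_flatten -map_comp sumnE big_map big_enum (bigD1 i) //=.
exact/leq_trans/leq_addr.
Qed.

(** A child is labeled by its own address unless it is a variable, and two
    children that are the same variable would give it two occurrences. *)
Lemma linear_label_inj (f : fun_symbol R) (ts : 'I_(farity f) -> term R n) p :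
  linear (App ts) -> injective (fun i => label (rcons p (nat_of_ord i)) (ts i)).
Proof.
move=> lin i j; have [//|ij] := eqVneq i j.
have lab k : (exists2 x, ts k = Var x & label (rcons p k) (ts k) = User x) \/
             label (rcons p k) (ts k) = New n (rcons p k).
  by case: (ts k) => [x||]; [left; exists x | right | right].
case: (lab i) => [[x tsi ->]|->]; case: (lab j) => [[y tsj ->]|->] //; last first.
  by case=> /(@rcons_inj _ _ _ _ _) [/val_inj].
case=> xy; have := lin x.
rewrite /= count_flatten -map_comp sumnE big_map big_enum (bigD1 i) //=.
by rewrite (bigD1 j) ?(eq_sym j) //= tsi tsj /= xy eqxx.
Qed.

Lemma label_child_neq (t : term R n) p k : label (rcons p k) t <> New n p.
Proof.
by case: t => [x|a|f ts] //= [] /(congr1 size); rewrite size_rcons => /esym/n_Sn.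
Qed.

Lemma node_constraints_inj (t : term R n) p : linear t ->
  all (fun pc => `[< injective (cargs (c := pc.2)) >]) (node_constraints p t).
Proof.
elim: t p => //= f ts IH p lin; apply/andP; split.
  apply/asboolP => i j.
  case: unliftP => [i' ->|->]; case: unliftP => [j' ->|->] //.
  - by move/(linear_label_inj lin) ->.
  - by move/label_child_neq.
  - by move/esym/label_child_neq.
rewrite all_flatten all_map; apply/allP => i _; apply: IH; exact: linear_sub lin.
Qed.

(** Constraints carry no decidable equality, so properties of all of them are
    stated with [all], which the recursion on terms computes. *)
Lemma tree_constraintsP (a : atom R n) (D : tvar n -> set R)
    (P : constraint R (tvar n) -> Prop) :
  (forall c : con (tree_icsp a D), P (cstr c)) <->
  all (fun pc => `[< P pc.2 >]) (atom_constraints a).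
Proof.
split=> [allP|/(all_tnthP (t := in_tuple _)) allP c]; last exact/asboolP/allP.
by apply/(all_tnthP (t := in_tuple _)) => c; apply/asboolP; exact: allP.
Qed.

Arguments tree_constraintsP a D P.

(** Each node shares its label with the constraint above it, through which
    nonemptiness passes from parent to children. *)
Lemma node_constraints_inhabited (D : tvar n -> set R) (t : term R n) p :
  D (label p t) !=set0 ->
  all (fun pc => `[< forall i j, D (cargs (c := pc.2) i) !=set0 ->
                                 D (cargs (c := pc.2) j) !=set0 >])
      (node_constraints p t) ->
  all (fun pc => `[< forall i, D (cargs (c := pc.2) i) !=set0 >])
      (node_constraints p t).
Proof.
elim: t p => //= f ts IH p Dp /andP[/asboolP spread].
rewrite !all_flatten !all_map => /allP sub.
have Dargs i := spread ord_max i _.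
rewrite /= unlift_none in Dargs.
apply/andP; split; first by apply/asboolP => i; exact: Dargs.
apply/allP => i ie; apply: IH (sub i ie).
by have := Dargs Dp (lift ord_max i); rewrite liftK.
Qed.

End TreeConstraints.

(** * The constraint g <= 0 *)

Section LeZero.
Local Open Scope classical_set_scope.
Context {R : realType} {F : set R} {n : nat}.
Context (g : term R n) (d : box R 2 -> box R 2) (D0 : tvar n -> set R).

Let S := tree_icsp (le_zero d g) D0.

Lemma le_zero_args_inj (c : con S) : linear g ->
  injective (cargs (c := cstr c)).
Proof.
move=> lin; move: c.
apply/(tree_constraintsP (le_zero d g) D0
         (fun c => injective (cargs (c := c)))).
rewrite /=; apply/andP; split.
  apply/asboolP => -[[|[|//]] i2] [[|[|//]] j2] //= lab;
    try exact: val_inj.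
    (* The remaining cases equate the label of [g] with that of the constant. *)
    by move: lab; case: (g).
  by move: lab; case: (g).
rewrite all_flatten all_map; apply/allP => i _ /=.
by case: eqP => // _; exact: node_constraints_inj.
Qed.

Lemma le_default_inhabited i : primitive F (le_symbol d) ->
  default_domain (p := le_symbol d) i !=set0.
Proof.
case=> _ opt.
have [_ cons _] := opt (fun=> setT) (fun=> fp_interval_setT) i.
exists 0%R; apply: cons; split=> //; apply; by exists (fun=> 0%R); split=> //=.
Qed.

Lemma all_constraints_neq0 : all_constraints S != finset.set0.
Proof. by apply/set0Pn; exists ord0; rewrite inE. Qed.

(** The root is not a seed, so its two domains contain 0 as the default domains
    of [<=] do; nonemptiness then reaches all nodes below. *)
Lemma no_seed_no_empty : linear g -> well_formed F S -> seeds S = finset.set0 ->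
  ~ has_empty S (dom S).
Proof.
move=> lin wfS noseed [c [i Di0]].
have primS (c' : con S) : primitive F (csym (cstr c')) by have [] := wfS c'.
have fpD : fp_doms F S (dom S) by move=> c'; have [] := wfS c'.
have injS (c' : con S) : injective (cargs (c := cstr c')) :=
  @le_zero_args_inj c' lin.
have nseed (c' : con S) : ~ seed c'.
  move=> sc'; have : c' \in seeds S by rewrite inE; apply/asboolP.
  by rewrite noseed inE.
have root i' : dom S (cargs (c := cstr (ord0 : con S)) i') !=set0.
  rewrite (_ : dom S _ = default_domain i').
    exact: le_default_inhabited (primS ord0).
  by apply: contrapT => ne; apply: (nseed ord0); exists i'.
have : forall c' : con S, forall i', D0 (cargs (c := cstr c') i') !=set0.
  apply/(tree_constraintsP (le_zero d g) D0 (fun c => forall i, D0 (cargs (c := c) i) !=set0)).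
  rewrite /=; apply/andP; split; first exact/asboolP.
  rewrite all_flatten all_map; apply/allP => i' _ /=.
  apply: node_constraints_inhabited; first exact: root i'.
  have /(tree_constraintsP (le_zero d g) D0 (fun c => forall i j,
      D0 (cargs (c := c) i) !=set0 -> D0 (cargs (c := c) j) !=set0)) /= :
      forall c' : con S, forall i j, D0 (cargs (c := cstr c') i) !=set0 ->
        D0 (cargs (c := cstr c') j) !=set0.
    move=> c' j k.
    apply: (stable_inhabited primS injS) => //; exact: nonseed_stable.
  move=> /andP[_]; rewrite all_flatten all_map => /allP; apply.
  exact: mem_enum.
by move=> /(_ c i); rewrite [D0 _]Di0 => -[].
Qed.

End LeZero.

Theorem theorem2 (R : realType) (F : set R) (hF : finite_set F)
    (n : nat) (g : term R n) (le_dro : box R 2 -> box R 2)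
    (D0 : tvar n -> set R)
    (glin : forall x : 'I_n, (count_mem x (occurrences g) <= 1)%N)
    (hS : well_formed F (tree_icsp (le_zero le_dro g) D0))
    (hconst : constant_domains F (le_zero le_dro g) D0) :
  let S := tree_icsp (le_zero le_dro g) D0 in
  exists o : outcome R (tvar n),
    gpa_result (deepest_first (@tree_level R n (le_zero le_dro g) D0))
      (seeds S) o /\
    gpa_result (any_order S) (all_constraints S) o.
Proof.
move=> S.
have primS (c : con S) : primitive F (csym (cstr c)) by have [] := hS c.
have fpD : fp_doms F S (dom S) by move=> c; have [] := hS c.
have injS (c : con S) : injective (cargs (c := cstr c)).
  exact: le_zero_args_inj.
apply: (gpa_result_eq hF primS injS) => //.
- move=> B /set0Pn[c0 c0B]; pose lev := @tree_level R n (le_zero le_dro g) D0.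
  by case: (arg_maxnP lev c0B) => c cB maxc; exists c.
- by move=> B /set0Pn[c cB]; exists c.
- move=> c; rewrite inE => /asboolPn; exact: nonseed_stable.
- by move=> c; rewrite inE.
- exact: no_seed_no_empty.
- by move/eqP; rewrite (negPf (all_constraints_neq0 _ _ _)).
Qed.
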